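(* Suppose assumptions A1–A4 hold. If the voltage magnitudes of all buses are fixed at the same value (that is, $\underline v_k=\overline v_k$ is the same number for all $k\in\mathcal{N}$), then the line $e^*$ returned by Algorithm 1 is optimal for OFR.
   Context: Network: $\mathcal{G}=(\mathcal{N},\mathcal{E})$ is a line network with buses $\mathcal{N}=\{0,1,\dots,n,0'\}$ ($0'$ is also written $n+1$) and directed lines $\mathcal{E}=\{(k,k+1):0\le k\le n\}$; the path between $0$ and $0'$ is $\mathcal{E}(0,0')=\mathcal{E}$. Buses $0,0'$ are substations, $1,\dots,n$ are load buses. Line $(i,j)$ has impedance $z_{ij}=r_{ij}+\mathbf{i}x_{ij}$ with resistance $r_{ij}\ge 0$ and $x_{ij}>0$. Variables: $x=(p,q,P,Q,\ell,v)$, real vectors with components $p_i,q_i,v_i$ ($i\in\mathcal{N}$: net real and reactive power injection, generation minus consumption, and squared voltage magnitude $v_i>0$) and $P_{ij},Q_{ij},\ell_{ij}$ ($(i,j)\in\mathcal{E}$: real and reactive branch power flow from $i$ to $j$, squared current magnitude $\ell_{ij}\ge 0$). Put $S_{ij}=P_{ij}+\mathbf{i}Q_{ij}$; for the reverse direction $S_{ji}=P_{ji}+\mathbf{i}Q_{ji}:=-S_{ij}+\ell_{ij}z_{ij}$. Feasible set: for a subgraph $\mathcal{G}'=(\mathcal{N}',\mathcal{E}')$ of $\mathcal{G}$, $\mathbb{X}(\mathcal{G}')$ is the set of all $x$ on $\mathcal{G}'$ satisfying, with all sums and indices over $\mathcal{G}'$, (a) $p_i=-\sum_{(k,i)\in\mathcal{E}'}(P_{ki}-\ell_{ki}r_{ki})+\sum_{(i,j)\in\mathcal{E}'}P_{ij}$,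 (b) $q_i=-\sum_{(k,i)\in\mathcal{E}'}(Q_{ki}-\ell_{ki}x_{ki})+\sum_{(i,j)\in\mathcal{E}'}Q_{ij}$, (c) $v_j=v_i-2(r_{ij}P_{ij}+x_{ij}Q_{ij})+\ell_{ij}|z_{ij}|^2$ for each line, (d) $\ell_{ij}v_i=P_{ij}^2+Q_{ij}^2$ for each line, (e) $\underline p_i\le p_i\le\overline p_i$, $\underline q_i\le q_i\le\overline q_i$, $\underline v_i\le v_i\le\overline v_i$, $\ell_{ij}\le\overline\ell_{ij}$, for given bounds. Problems: $\Gamma(p_0,p_{0'})$ is a convex increasing cost function. OPF-$\mathcal{G}$ is $\min_{x\in\mathbb{X}(\mathcal{G})}\Gamma(p_0,p_{0'})$. Removing line $(k,k+1)$ leaves two subtrees: $\mathcal{G}_0^{k}$ on buses $\{0,\dots,k\}$ and $\mathcal{G}_{0'}^{k+1}$ on buses $\{k+1,\dots,n+1\}$. Define $p_0^k:=\min_{x\in\mathbb{X}(\mathcal{G}_0^k)}p_0$ and $p_{0'}^{k+1}:=\min_{x\in\mathbb{X}(\mathcal{G}_{0'}^{k+1})}p_{0'}$. The problem OFR is $\min_{(k,k+1)\in\mathcal{E}(0,0')}\Gamma(p_0^k,p_{0'}^{k+1})$; a line is optimal for OFR if it attains this minimum. Algorithm 1: solve OPF-$\mathcal{G}$ and let $x^*$ be an optimal solution; then 1) if $P^*_{0,1}\le 0$: $e^*=(0,1)$; 2) if $P^*_{n,0'}\ge 0$: $e^*=(n,0')$; 3) if there is a line $(k,k+1)$ with $P^*_{k,k+1}\ge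 0$ and $P^*_{k+1,k}\ge 0$: $e^*=(k,k+1)$; 4) if there are consecutive lines $(k-1,k),(k,k+1)$ with $P^*_{k,k-1}\le 0$ and $P^*_{k,k+1}\le 0$: $e^*=(k,k+1)$ if $\Gamma(p_0^{k-1},p_{0'}^{k})\ge\Gamma(p_0^{k},p_{0'}^{k+1})$, and $e^*=(k-1,k)$ otherwise. Assumptions: A1: $\overline p_k<0$ for $1\le k\le n$ and $\overline p_k>0$ for $k=0,0'$. A2: $\overline v_k=\underline v_k$ and $\overline q_k=-\underline q_k=\infty$ for all $k\in\mathcal{N}$. A3: $|\theta_i-\theta_j|<\arctan(x_{ij}/r_{ij})$ for $(i,j)\in\mathcal{E}$, where the voltage angle difference is determined by the power flow variables through $\theta_i-\theta_j=\angle(v_i-z_{ij}^*S_{ij})$ ($z^*$ denotes complex conjugate). A4: the feasible set $\mathbb{X}(\mathcal{G})$ is compact, and the optimization problems under consideration are feasible. *)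

(* Defs.v *)
From HB Require Import structures.
From mathcomp Require Import all_boot all_order all_algebra.
From mathcomp Require Import complex.
From mathcomp Require Import all_classical all_reals all_analysis.

Set Implicit Arguments.
Unset Strict Implicit.
Unset Printing Implicit Defensive.

Import Order.TTheory GRing.Theory Num.Theory.
Import numFieldNormedType.Exports.

Local Open Scope classical_set_scope.
Local Open Scope ring_scope.

(* Buses 0, ..., n, n+1 are 'I_n.+2 (ord_max is the substation 0'); the line
   (k, k+1) is represented by k : 'I_n.+1. *)
Definition src n (e : 'I_n.+1) : 'I_n.+2 := widen_ord (leqnSn n.+1) e.
Definition dst n (e : 'I_n.+1) : 'I_n.+2 := lift ord0 e.

(* Bounds are extended reals, an infinite bound meaning "no constraint". *)
Record network (R : realType) (n : nat) := Network {
  resistance : 'I_n.+1 -> R;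
  reactance : 'I_n.+1 -> R;
  pmin : 'I_n.+2 -> \bar R;
  pmax : 'I_n.+2 -> \bar R;
  qmin : 'I_n.+2 -> \bar R;
  qmax : 'I_n.+2 -> \bar R;
  vmin : 'I_n.+2 -> \bar R;
  vmax : 'I_n.+2 -> \bar R;
  lmax : 'I_n.+1 -> \bar R;
  resistance_ge0 : forall e, 0 <= resistance e;
  reactance_gt0 : forall e, 0 < reactance e
}.

(* A point (p, q, P, Q, l, v), as a product of row vectors so that it carries
   the usual topology of a finite-dimensional real space. *)
Definition state (R : realType) (n : nat) : Type :=
  ('rV[R]_n.+2 * 'rV[R]_n.+2 * 'rV[R]_n.+1 * 'rV[R]_n.+1
   * 'rV[R]_n.+1 * 'rV[R]_n.+2)%type.

Section State.
Variables (R : realType) (n : nat).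
Implicit Types (x : state R n) (i : 'I_n.+2) (e : 'I_n.+1).

Definition pinj x i : R := x.1.1.1.1.1 ord0 i.
Definition qinj x i : R := x.1.1.1.1.2 ord0 i.
Definition Pflow x e : R := x.1.1.1.2 ord0 e.
Definition Qflow x e : R := x.1.1.2 ord0 e.
Definition lsq x e : R := x.1.2 ord0 e.
Definition vsq x i : R := x.2 ord0 i.

End State.

Section Model.
Variables (R : realType) (n : nat) (G : network R n).
Implicit Types (x : state R n) (i : 'I_n.+2) (e : 'I_n.+1).

Definition impedance e : R[i] := (resistance G e +i* reactance G e)%C.

Definition Sflow x e : R[i] := (Pflow x e +i* Qflow x e)%C.

(* Flow on line e = (i, j) in the reverse direction: S_ji, P_ji. *)
Definition Sflow_rev x e : R[i] :=
  - Sflow x e + (lsq x e)%:C%C * impedance e.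
Definition Pflow_rev x e : R := complex.Re (Sflow_rev x e).

Definition within (lo : \bar R) (a : R) (hi : \bar R) : Prop :=
  (lo <= a%:E)%E /\ (a%:E <= hi)%E.

(* The feasible set of the subgraph with buses N' and lines E'. Vectors indexed
   by N' (resp. E') are encoded as vectors on the whole network that vanish
   outside N' (resp. E'). *)
Definition feasible (N' : {set 'I_n.+2}) (E' : {set 'I_n.+1}) :
    set (state R n) :=
  [set x | [/\
    (forall i, i \in N' -> 0 < vsq x i) /\
    (forall e, e \in E' -> 0 <= lsq x e),
    (forall i, i \in N' ->
       pinj x i =
         - (\sum_(e in E' | dst e == i)
              (Pflow x e - lsq x e * resistance G e))
         + \sum_(e in E' | src e == i) Pflow x e) /\
    (forall i, i \in N' ->
       qinj x i =
         - (\sum_(e in E' | dst e == i)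
              (Qflow x e - lsq x e * reactance G e))
         + \sum_(e in E' | src e == i) Qflow x e),
    (forall e, e \in E' ->
       vsq x (dst e) = vsq x (src e)
         - 2 * (resistance G e * Pflow x e + reactance G e * Qflow x e)
         + lsq x e * (resistance G e ^+ 2 + reactance G e ^+ 2)) /\
    (forall e, e \in E' ->
       lsq x e * vsq x (src e) = Pflow x e ^+ 2 + Qflow x e ^+ 2),
    (forall i, i \in N' ->
       [/\ within (pmin G i) (pinj x i) (pmax G i),
           within (qmin G i) (qinj x i) (qmax G i) &
           within (vmin G i) (vsq x i) (vmax G i)]) /\
    (forall e, e \in E' -> ((lsq x e)%:E <= lmax G e)%E) &
    (forall i, i \notin N' -> [/\ pinj x i = 0, qinj x i = 0 & vsq x i = 0]) /\
    (forall e, e \notin E' ->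
       [/\ Pflow x e = 0, Qflow x e = 0 & lsq x e = 0])]].

Definition feasible_net : set (state R n) := feasible [set: _]%SET [set: _]%SET.

(* The two subtrees obtained by removing line k = (k, k+1). *)
Definition feasible_left (k : 'I_n.+1) : set (state R n) :=
  feasible [set i : 'I_n.+2 | (i <= k)%N]%SET [set e : 'I_n.+1 | (e < k)%N]%SET.
Definition feasible_right (k : 'I_n.+1) : set (state R n) :=
  feasible [set i : 'I_n.+2 | (k < i)%N]%SET [set e : 'I_n.+1 | (k < e)%N]%SET.

(* The minimum of a set of reals (0 if there is none). *)
Definition minimum (A : set R) : R := xget 0 (A `&` lbound A).

(* p_0^k and p_{0'}^{k+1}. *)
Definition p0_left (k : 'I_n.+1) : R :=
  minimum [set pinj x ord0 | x in feasible_left k].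
Definition p0_right (k : 'I_n.+1) : R :=
  minimum [set pinj x ord_max | x in feasible_right k].

Variable Gamma : R * R -> R.

Definition OPF_optimal x : Prop :=
  feasible_net x /\
  forall y, feasible_net y ->
    Gamma (pinj x ord0, pinj x ord_max) <= Gamma (pinj y ord0, pinj y ord_max).

Definition OFR_cost (k : 'I_n.+1) : R := Gamma (p0_left k, p0_right k).

Definition OFR_optimal (k : 'I_n.+1) : Prop :=
  forall j : 'I_n.+1, OFR_cost k <= OFR_cost j.

(* [alg1 x e]: starting from the OPF solution x, some applicable case of the
   algorithm returns line e. The cases are not assumed to be exclusive. *)
Inductive alg1 x : 'I_n.+1 -> Prop :=
| alg1_first : Pflow x ord0 <= 0 -> alg1 x ord0
| alg1_last : 0 <= Pflow x ord_max -> alg1 x ord_max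
| alg1_line e : 0 <= Pflow x e -> 0 <= Pflow_rev x e -> alg1 x e
| alg1_bus (d e : 'I_n.+1) : e = d.+1 :> nat ->
    Pflow_rev x d <= 0 -> Pflow x e <= 0 ->
    alg1 x (if OFR_cost e <= OFR_cost d then e else d).

(* Argument in ]-pi, pi] of a nonzero complex number. *)
Definition arg (w : R[i]) : R :=
  let t := acos (complex.Re w / Normc.normc w) in
  if 0 <= complex.Im w then t else - t.

(* theta_i - theta_j for e = (i, j). *)
Definition angle_diff x e : R :=
  arg ((vsq x (src e))%:C%C - (impedance e)^*%C * Sflow x e).

(* arctan (x_ij / r_ij), read as pi / 2 when r_ij = 0. *)
Definition angle_bound e : R :=
  if resistance G e == 0 then pi / 2
  else atan (reactance G e / resistance G e).

Definition is_substation i : bool := (i == ord0) || (i == ord_max).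

Definition A1 : Prop :=
  (forall i, ~~ is_substation i -> (pmax G i < 0)%E) /\
  (forall i, is_substation i -> (0 < pmax G i)%E).

Definition A2 : Prop :=
  forall i, [/\ vmax G i = vmin G i, qmax G i = +oo%E & qmin G i = -oo%E].

Definition A3 : Prop :=
  forall x, feasible_net x -> forall e, `|angle_diff x e| < angle_bound e.

Definition A4 : Prop :=
  [/\ compact feasible_net, feasible_net !=set0,
      forall k, feasible_left k !=set0 & forall k, feasible_right k !=set0].

End Model.

Definition convex_cost (R : realType) (Gamma : R * R -> R) : Prop :=
  @convex_function R (R^o * R^o)%type [set: _] Gamma.

Definition increasing_cost (R : realType) (Gamma : R * R -> R) : Prop :=
  forall a b a' b' : R, a <= a' -> b <= b' -> Gamma (a, b) <= Gamma (a', b').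

(* Main.v *)
Require Import Defs.
From mathcomp Require Import all_boot all_order all_algebra.
From mathcomp Require Import complex ring lra zify.
From mathcomp Require Import all_classical all_reals all_analysis.

Set Implicit Arguments.
Unset Strict Implicit.
Unset Printing Implicit Defensive.

Import Order.TTheory GRing.Theory Num.Theory.
Import numFieldNormedType.Exports.

Local Open Scope classical_set_scope.
Local Open Scope ring_scope.

(** With all squared voltage magnitudes equal to [V], the two power flow
    equations of a line leave one degree of freedom. In the coordinate
    [u = c * sin theta], where [c = 2 V / |z|^2], the squared current is
    [c - sqrt (c^2 - u^2)], and the power [sent] into the line and the power
    [received] at its other end are half of [u] times the reactance, plus or
    minus half the loss. The angle condition [A3] says exactly that [u] lies on the arc where both are
    strictly increasing. On this arc the loss is convex, so [sent] is convex
    and [received] is concave, and the relaxed line constraint that the line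
    delivers at most [received u] for at least [sent u] ([relaxed]) is stable
    under convex combinations.

    Reactive injections being free, a state is just a choice of [u] on every
    line, subject to the bounds on the real power balance of the buses. Cut the
    network at line [k] and let every load draw its least consumption
    [- pmax > 0]; this determines all flows, going outward from the cut
    ([cut_profile]). Since the loads are positive, all these flows are directed
    towards the cut, and they are the smallest possible: any flow that meets
    the relaxed line constraints and the upper load bounds, and whose flow on
    line [k] does not feed either side, needs at least as much power at both
    substations ([chain_dominated], [cut_left], [cut_right]). Hence this state
    attains both [p0_left k] and [p0_right k] ([p0_leftE], [p0_rightE]) and the
    OFR cost of [k] is at most the cost of any such relaxed flow
    ([OFR_cost_le]).

    Let [x] be optimal for OPF; its cost is a lower bound for every OFR cost,
    because the cut state of [j] is feasible for the whole network. If both ends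
    of line [k] send power in [x], then [x] itself is such a relaxed flow and
    [k] is optimal. If instead bus [k] receives power from line [k] in [x], or
    nothing, while [j] is at or to the right of [k], then in the cut state of
    [j] bus [k] sends power into that line, or nothing, so that some convex
    combination of the two has zero flow at the left end of [k]. It is a
    relaxed flow of the required kind, and by convexity of the cost it costs at
    most as much as the cut state of [j]; so [k] is no worse than [j]
    ([OFR_cost_le_right], and symmetrically [OFR_cost_le_left]). Each case of
    the algorithm combines these three comparisons. *)

(** * Minima, convex costs and arguments *)

Lemma minimumP (R : realType) (A : set R) (a : R) :
  A a -> (forall b, A b -> a <= b) -> minimum A = a.
Proof.
move=> Aa lb; apply: xget_unique => [|b [Ab bl]]; first by split=> // b /lb.
by apply/eqP; rewrite eq_le lb// bl.
Qed.

Lemma convex_costP (R : realType) (Gamma : R * R -> R) (t a b a' b' : R) :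
  convex_cost Gamma -> 0 <= t <= 1 ->
  Gamma (t * a + (1 - t) * a', t * b + (1 - t) * b')
    <= t * Gamma (a, b) + (1 - t) * Gamma (a', b').
Proof.
move=> hconvex /andP[t0 t1].
exact: hconvex (Itv01 t0 t1) (a, b) (a', b') (mem_setT _) (mem_setT _).
Qed.

Lemma convex_zero (R : realFieldType) (a b : R) : a <= 0 -> 0 <= b ->
  exists2 t, 0 <= t <= 1 & t * a + (1 - t) * b = 0.
Proof.
move=> a0 b0; have [ab|ab] := eqVneq a b.
  exists 0; first by rewrite lexx ler01.
  by rewrite mul0r subr0 mul1r add0r; apply/eqP; rewrite eq_le b0 -ab a0.
have ab0 : 0 < b - a by rewrite subr_gt0 lt_neqAle ab (le_trans a0).
exists (b / (b - a)).
  by rewrite divr_ge0 ?(ltW ab0)//= ler_pdivrMr// mul1r; lra.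
by field; rewrite lt0r_neq0.
Qed.

Lemma normr_arg (R : realType) (a b : R) : 0 < a ^+ 2 + b ^+ 2 ->
  `|arg (a +i* b)%C| = acos (a / Num.sqrt (a ^+ 2 + b ^+ 2)).
Proof.
move=> h; rewrite /arg /=.
suff t0 : 0 <= acos (a / Num.sqrt (a ^+ 2 + b ^+ 2)).
  by case: ifP => _; rewrite ?normrN ger0_norm.
apply: acos_ge0; have s0 : 0 < Num.sqrt (a ^+ 2 + b ^+ 2) by rewrite sqrtr_gt0.
have : `|a| <= Num.sqrt (a ^+ 2 + b ^+ 2).
  by rewrite -sqrtr_sqr ler_wsqrtr// lerDl sqr_ge0.
by rewrite ler_norml ler_pdivlMr// ler_pdivrMr// mulN1r mul1r.
Qed.

(** * A single line at constant voltage *)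

(** The last two data are the radius [c = 2 V / |z|^2] of the circle on which
    [u] and [height] lie, and the bound on the squared current. *)
Record line (R : realType) := Line {
  lres : R;
  lrea : R;
  lrad : R;
  lcap : \bar R;
  lres_ge0 : 0 <= lres;
  lrea_gt0 : 0 < lrea;
  lrad_gt0 : 0 < lrad
}.

Section Line.
Context {R : realType}.
Implicit Types (L : line R) (u w t : R).

(** With [u = c * sin theta], [height] is [c * cos theta]. *)
Definition height L u : R := Num.sqrt (lrad L ^+ 2 - u ^+ 2).
Definition current L u : R := lrad L - height L u.
Definition sent L u : R := (lrea L * u + lres L * current L u) / 2.
Definition received L u : R := (lrea L * u - lres L * current L u) / 2.

(** The first condition is [|tan theta| < x / r], multiplied out so that it also
    makes sense for [r = 0] and forces [cos theta > 0]. *)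
Definition operable L u : Prop :=
  lres L * `|u| < lrea L * height L u /\ ((current L u)%:E <= lcap L)%E.

Lemma height_ge0 L u : 0 <= height L u.
Proof. exact: sqrtr_ge0. Qed.

Lemma heightN L u : height L (- u) = height L u.
Proof. by rewrite /height sqrrN. Qed.

Lemma height_le L u w : `|u| <= `|w| -> height L w <= height L u.
Proof.
move=> uw; apply: ler_wsqrtr; rewrite lerD2l lerN2.
by rewrite -[u ^+ 2]real_normK ?num_real// -[w ^+ 2]real_normK ?num_real// lerXn2r ?nnegrE.
Qed.

Lemma height0 L : height L 0 = lrad L.
Proof. by rewrite /height expr0n subr0 sqrtr_sqr gtr0_norm ?lrad_gt0. Qed.

Lemma current_ge0 L u : 0 <= current L u.
Proof. by rewrite subr_ge0 -[leRHS](height0 L) height_le// normr0. Qed.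

Lemma current0 L : current L 0 = 0.
Proof. by rewrite /current height0 subrr. Qed.

Lemma sent0 L : sent L 0 = 0.
Proof. by rewrite /sent current0 !mulr0 addr0 mul0r. Qed.

Lemma received0 L : received L 0 = 0.
Proof. by rewrite /received current0 !mulr0 subr0 mul0r. Qed.

(** Changing the sign of [u] exchanges the two ends of the line. *)
Lemma sentN L u : sent L (- u) = - received L u.
Proof. by rewrite /sent /received /current heightN; field. Qed.

Lemma receivedN L u : received L (- u) = - sent L u.
Proof. by rewrite /sent /received /current heightN; field. Qed.

Lemma received_le_sent L u : received L u <= sent L u.
Proof.
have := mulr_ge0 (lres_ge0 L) (current_ge0 L u).
by rewrite /received /sent; lra.
Qed.

Lemma sent_ge0 L u : 0 <= u -> 0 <= sent L u.
Proof.
move=> u0; have := mulr_ge0 (lres_ge0 L) (current_ge0 L u).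
by have := mulr_ge0 (ltW (lrea_gt0 L)) u0; rewrite /sent; lra.
Qed.

Lemma operable_height_gt0 L u : operable L u -> 0 < height L u.
Proof.
move=> [h _]; rewrite -(pmulr_rgt0 _ (lrea_gt0 L)).
by apply: le_lt_trans h; rewrite mulr_ge0 ?lres_ge0.
Qed.

Lemma sqr_height L u : operable L u -> height L u ^+ 2 + u ^+ 2 = lrad L ^+ 2.
Proof.
move=> /operable_height_gt0; rewrite sqrtr_gt0 => /ltW h.
by rewrite sqr_sqrtr// subrK.
Qed.

Lemma operable_le L u w : operable L u -> `|w| <= `|u| -> operable L w.
Proof.
move=> [ur uc] wu; have hwu := height_le L wu; split.
  apply: le_lt_trans (ler_wpM2l (lres_ge0 L) wu) _; apply: lt_le_trans ur _.
  by rewrite ler_pM2l ?lrea_gt0.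
by apply: le_trans uc; rewrite lee_fin lerD2l lerN2.
Qed.

Lemma operableN L u : operable L u -> operable L (- u).
Proof. by move=> h; apply: operable_le h _; rewrite normrN. Qed.

(** The slope of [height] on the circle is [- u / height], which the angle
    condition bounds by [x / r]; this is what makes both end flows monotone. *)
Lemma height_lipschitz L u w : operable L u -> operable L w -> u < w ->
  lres L * `|height L w - height L u| < lrea L * (w - u).
Proof.
move=> ou ow uw.
have hu := operable_height_gt0 ou; have hw := operable_height_gt0 ow.
have eu := sqr_height ou; have ew := sqr_height ow.
have hh : 0 < height L u + height L w by rewrite addr_gt0.
rewrite -(ltr_pM2r hh) -mulrA -[X in _ * (_ * X)]gtr0_norm// -normrM.
have -> : (height L w - height L u) * (height L u + height L w)
    = - ((w - u) * (u + w)) by move: eu ew; rewrite !expr2; lra.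
rewrite normrN normrM [`|w - u|]gtr0_norm ?subr_gt0//.
rewrite mulrCA -[ltRHS]mulrA [ltRHS]mulrCA ltr_pM2l ?subr_gt0//.
apply: le_lt_trans (ler_wpM2l (lres_ge0 L) (ler_normD u w)) _.
by case: ou => ou _; case: ow => ow _; rewrite !mulrDr ltrD.
Qed.

Lemma sent_lt L u w : operable L u -> operable L w -> u < w -> sent L u < sent L w.
Proof.
move=> ou ow uw; have := height_lipschitz ou ow uw.
have := ler_wpM2l (lres_ge0 L) (ler_norm (height L w - height L u)).
by rewrite /sent /current; lra.
Qed.

Lemma received_lt L u w : operable L u -> operable L w -> u < w ->
  received L u < received L w.
Proof.
by move=> ou ow uw; rewrite -ltrN2 -!sentN; apply: sent_lt;
  [exact: operableN|exact: operableN|rewrite ltrN2].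
Qed.

Lemma sent_le L u w : operable L u -> operable L w -> u <= w -> sent L u <= sent L w.
Proof. by move=> ou ow; rewrite le_eqVlt => /orP[/eqP->//|/(sent_lt ou ow)/ltW]. Qed.

(** A chord of a disc lies inside the disc. *)
Lemma height_concave L t u w : 0 <= t <= 1 -> operable L u -> operable L w ->
  t * height L u + (1 - t) * height L w <= height L (t * u + (1 - t) * w).
Proof.
move=> /andP[t0 t1] ou ow.
have hu := height_ge0 L u; have hw := height_ge0 L w.
have eu := sqr_height ou; have ew := sqr_height ow.
have t'0 : 0 <= 1 - t by rewrite subr_ge0.
set a := (X in X <= _).
have a0 : 0 <= a by rewrite addr_ge0// mulr_ge0.
rewrite -[a]ger0_norm// -sqrtr_sqr; apply: ler_wsqrtr; rewrite /a.
have := sqr_ge0 (height L u - height L w); have := sqr_ge0 (u - w).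
move: (height L u) (height L w) (lrad L) eu ew => A B C eu ew h1 h2.
have h3 : 0 <= t * (1 - t) * (2 * C ^+ 2 - 2 * (A * B) - 2 * (u * w)).
  by rewrite mulr_ge0 ?mulr_ge0//; move: h1 h2 eu ew; rewrite !expr2; lra.
have -> : C ^+ 2 - (t * u + (1 - t) * w) ^+ 2
  = (t * A + (1 - t) * B) ^+ 2 + t * (1 - t) * (2 * C ^+ 2 - 2 * (A * B) - 2 * (u * w)).
  have eA : A ^+ 2 = C ^+ 2 - u ^+ 2 by rewrite -eu addrK.
  have eB : B ^+ 2 = C ^+ 2 - w ^+ 2 by rewrite -ew addrK.
  by ring: eA eB.
by rewrite lerDl.
Qed.

Lemma operable_convex L t u w : 0 <= t <= 1 -> operable L u -> operable L w ->
  operable L (t * u + (1 - t) * w).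
Proof.
move=> t01 ou ow; have hc := height_concave t01 ou ow.
case/andP: t01 => t0 t1; case: ou ow => ur uc [wr wc].
have t'0 : 0 <= 1 - t by rewrite subr_ge0.
split; last first.
  have : t * current L u + (1 - t) * current L w <= Num.max (current L u) (current L w).
    set m := Num.max _ _.
    have mu : current L u <= m by rewrite le_max lexx.
    have mw : current L w <= m by rewrite le_max lexx orbT.
    by have := ler_wpM2l t0 mu; have := ler_wpM2l t'0 mw; lra.
  move=> h; apply: (@le_trans _ _ (Num.max (current L u) (current L w))%:E).
    by rewrite lee_fin; apply: le_trans h; rewrite /current; lra.
  by rewrite EFin_max ge_max uc wc.
have rh := ler_wpM2l (ltW (lrea_gt0 L)) hc.
have hn : `|t * u + (1 - t) * w| <= t * `|u| + (1 - t) * `|w|.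
  by apply: le_trans (ler_normD _ _) _; rewrite !normrM (ger0_norm t0) (ger0_norm t'0).
have {}hn := ler_wpM2l (lres_ge0 L) hn.
have [t_0|tn0] := eqVneq t 0.
  by rewrite t_0 !mul0r !add0r subr0 !mul1r.
have {}t0 : 0 < t by rewrite lt_neqAle eq_sym tn0.
have := ler_wpM2l t'0 (ltW wr); move: ur; rewrite -(ltr_pM2l t0) => ur.
by lra.
Qed.

Lemma sent_convex L t u w : 0 <= t <= 1 -> operable L u -> operable L w ->
  sent L (t * u + (1 - t) * w) <= t * sent L u + (1 - t) * sent L w.
Proof.
move=> t01 ou ow; have := ler_wpM2l (lres_ge0 L) (height_concave t01 ou ow).
by rewrite /sent /current; lra.
Qed.

Lemma received_concave L t u w : 0 <= t <= 1 -> operable L u -> operable L w ->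
  t * received L u + (1 - t) * received L w <= received L (t * u + (1 - t) * w).
Proof.
move=> t01 ou ow; have := ler_wpM2l (lres_ge0 L) (height_concave t01 ou ow).
by rewrite /received /current; lra.
Qed.

Lemma received_continuous L : continuous (received L).
Proof.
move=> u; apply: cvgM; last exact: cvg_cst.
have hc : height L u @[u --> u] --> height L u.
  apply: (@continuous_comp _ _ _ (fun u => lrad L ^+ 2 - u ^+ 2) Num.sqrt).
    by apply: cvgB; [exact: cvg_cst|exact: exprn_continuous].
  exact: sqrt_continuous.
apply: cvgB; first by apply: cvgM; [exact: cvg_cst|exact: cvg_id].
by apply: cvgM; [exact: cvg_cst|apply: cvgB; [exact: cvg_cst|exact: hc]].
Qed.

Lemma received_onto L u t : 0 <= u -> 0 <= t <= received L u ->
  exists2 w, 0 <= w <= u & received L w = t.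
Proof.
move=> u0 /andP[t0 tu].
have [||w] := @IVT R (received L) 0 u t u0.
- by apply: continuous_subspaceT; exact: received_continuous.
- by rewrite received0 ge_min t0 le_max tu orbT.
by rewrite in_itv/=; exists w.
Qed.

(** Flows that enter and leave the line when part of the power may be thrown
    away at either end; this is the convex relaxation of the line equations. *)
Definition relaxed L (F H : R) : Prop :=
  exists u, [/\ operable L u, sent L u <= F & H <= received L u].

Lemma relaxed_le L F H : relaxed L F H -> H <= F.
Proof.
by move=> [u [_ uF Hu]]; apply: le_trans Hu (le_trans _ uF); exact: received_le_sent.
Qed.

Lemma relaxedN L F H : relaxed L F H -> relaxed L (- H) (- F).
Proof.
move=> [u [ou uF Hu]]; exists (- u).
by rewrite sentN receivedN !lerN2; split => //; exact: operableN.
Qed.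

Lemma relaxed_convex L t F H F' H' : 0 <= t <= 1 ->
  relaxed L F H -> relaxed L F' H' ->
  relaxed L (t * F + (1 - t) * F') (t * H + (1 - t) * H').
Proof.
move=> t01 [u [ou uF Hu]] [w [ow wF Hw]]; exists (t * u + (1 - t) * w).
have [t0 t1] := andP t01; have t'0 : 0 <= 1 - t by rewrite subr_ge0.
split; first exact: operable_convex.
- by apply: le_trans (sent_convex t01 ou ow) _; rewrite lerD// ler_wpM2l.
- by apply: le_trans (received_concave t01 ou ow); rewrite lerD// ler_wpM2l.
Qed.

End Line.

(** * Least flows away from a cut *)

Section Cut.
Context {R : realType}.
Implicit Types (d F H : nat -> R) (u w : nat -> R).

(** Lines are numbered outward from the cut, which is line [0] and carries
    nothing; [u] is counted positive towards the cut. Between lines [m] and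
    [m.+1] a bus draws [d m.+1], and line [m.+1] must deliver that load together
    with what line [m] takes. *)
Fixpoint chain (L : nat -> line R) d m : R :=
  if m is m'.+1 then
    xget 0 [set u | operable (L m) u /\
                    received (L m) u = sent (L m') (chain L d m') + d m]
  else 0.

(** Induction outward from the cut: a larger demand at the near end of a line
    means more power sent at its far end, by monotonicity, and the relaxed flow
    exhibits a point of the arc where the demand is at least met, so that the
    intermediate value theorem provides the exact solution below it. *)
Lemma chain_dominated (L : nat -> line R) d F H N :
  (forall m, (m <= N)%N -> relaxed (L m) (F m) (H m)) -> 0 <= F 0 ->
  (forall m, (m < N)%N -> 0 <= d m.+1) ->
  (forall m, (m < N)%N -> F m + d m.+1 <= H m.+1) ->
  forall m, (m <= N)%N ->
  [/\ operable (L m) (chain L d m), 0 <= chain L d m,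
      sent (L m) (chain L d m) <= F m &
      forall m', m = m'.+1 ->
        received (L m) (chain L d m) = sent (L m') (chain L d m') + d m].
Proof.
move=> hrel hF0 hd hFH; elim=> [_|m IH mN].
  have [u [ou _ _]] := hrel 0 (leq0n N).
  by split; rewrite ?lexx ?sent0 //=; apply: operable_le ou _; rewrite normr0.
have [_ T0 TF _] := IH (ltnW mN).
have [c [oc cF Hc]] := hrel m.+1 mN.
pose t := sent (L m) (chain L d m) + d m.+1.
have t0 : 0 <= t by rewrite addr_ge0 ?hd// sent_ge0.
have tc : t <= received (L m.+1) c.
  by apply: le_trans Hc; apply: le_trans (hFH m mN); rewrite lerD2r.
have c0 : 0 <= c.
  rewrite leNgt; apply/negP => cN.
  have o0 : operable (L m.+1) 0 by apply: operable_le oc _; rewrite normr0.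
  have := received_lt oc o0 cN.
  by rewrite received0 ltNge (le_trans t0 tc).
have /= [] : [set u | operable (L m.+1) u /\ received (L m.+1) u = t] (chain L d m.+1).
  apply: xgetPex; have t0c : 0 <= t <= received (L m.+1) c by rewrite t0.
  have [w /andP[w0 wc] wt] := received_onto c0 t0c.
  by exists w; split=> //; apply: operable_le oc _; rewrite !ger0_norm.
rewrite -/(chain L d m.+1) => oT eT.
have Tc : chain L d m.+1 <= c.
  rewrite leNgt; apply/negP => /(received_lt oc oT).
  by rewrite eT ltNge tc.
split=> //.
- rewrite leNgt; apply/negP => TN.
  have o0 : operable (L m.+1) 0 by apply: operable_le oc _; rewrite normr0.
  have := received_lt oT o0 TN.
  by rewrite received0 eT ltNge t0.
- by apply: le_trans (sent_le oT oc Tc) cF.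
- by move=> _ [<-].
Qed.

Variables (n : nat) (L : nat -> line R) (d : nat -> R).

(** Bus [i.+1], between lines [i] and [i.+1], draws [d i.+1]. To the right of the
    cut, power runs towards decreasing indices, hence the sign. *)
Definition cut_profile (k i : nat) : R :=
  if (i <= k)%N then chain (fun m => L (k - m)%N) (fun m => d (k - m).+1%N) (k - i)
  else - chain (fun m => L (k + m)%N) (fun m => d (k + m)%N) (i - k).

(** [F i] enters line [i] at its left end and [H i] leaves it at its right end;
    only the lower bounds on the consumption of the load buses are kept. *)
Definition relaxed_flow F H : Prop :=
  (forall i, (i <= n)%N -> relaxed (L i) (F i) (H i)) /\
  (forall i, (i < n)%N -> F i.+1 + d i.+1 <= H i).

Hypothesis d_ge0 : forall i, (i < n)%N -> 0 <= d i.+1.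

Lemma cut_profileE k : cut_profile k k = 0.
Proof. by rewrite /cut_profile leqnn subnn. Qed.

Lemma cut_left k F H : (k <= n)%N -> relaxed_flow F H -> 0 <= F k ->
  forall i, (i <= k)%N ->
  [/\ operable (L i) (cut_profile k i), 0 <= cut_profile k i,
      sent (L i) (cut_profile k i) <= F i &
      (i < k)%N -> received (L i) (cut_profile k i)
        = sent (L i.+1) (cut_profile k i.+1) + d i.+1].
Proof.
move=> kn [hrel hFH] Fk i ik.
have [| | | |o T0 TF eT] := @chain_dominated (fun m => L (k - m)%N) (fun m => d (k - m).+1%N)
  (fun m => F (k - m)%N) (fun m => H (k - m)%N) k _ _ _ _ (k - i) (leq_subr _ _).
- by move=> m mk; apply: hrel; lia.
- by rewrite subn0.
- by move=> m mk; apply: d_ge0; lia.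
- move=> m mk; have -> : (k - m = (k - m.+1).+1)%N by lia.
  by apply: hFH; lia.
have iE : (k - (k - i) = i)%N by lia.
rewrite iE in o TF eT; rewrite /cut_profile ik; split=> // ltik; rewrite ltik.
by rewrite (eT (k - i.+1)%N); [congr (sent (L _) _ + _); lia|lia].
Qed.

(** The mirror image of [cut_left]: reversing the direction of all lines turns
    the relaxed flow [(F, H)] into [(- H, - F)]. *)
Lemma cut_right k F H : (k <= n)%N -> relaxed_flow F H -> H k <= 0 ->
  forall i, (k <= i <= n)%N ->
  [/\ operable (L i) (cut_profile k i), cut_profile k i <= 0,
      H i <= received (L i) (cut_profile k i) &
      (k < i)%N -> sent (L i) (cut_profile k i) + d i
        = received (L i.-1) (cut_profile k i.-1)].
Proof.
move=> kn [hrel hFH] Hk i /andP[ki i_n].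
have [| | | ||o T0 TF eT] := @chain_dominated (fun m => L (k + m)%N) (fun m => d (k + m)%N)
  (fun m => - H (k + m)%N) (fun m => - F (k + m)%N) (n - k) _ _ _ _ (i - k).
- by move=> m mk; apply/relaxedN/hrel; lia.
- by rewrite addn0 oppr_ge0.
- by move=> m mk; rewrite addnS; apply: d_ge0; lia.
- by move=> m mk; rewrite addnS; have := hFH (k + m)%N; rewrite (_ : (_ < n)%N); [lra|lia].
- by lia.
have iE : (k + (i - k) = i)%N by lia.
rewrite iE in o TF eT.
have TE j : (k <= j)%N ->
    cut_profile k j = - chain (fun m => L (k + m)%N) (fun m => d (k + m)%N) (j - k).
  rewrite /cut_profile leq_eqVlt => /orP[/eqP<-|kj]; first by rewrite leqnn subnn oppr0.
  by rewrite leqNgt kj.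
rewrite (TE i)//; split.
- exact: operableN.
- by rewrite oppr_le0.
- by rewrite receivedN lerNr.
- move=> ltki; have /eT e : (i - k = (i.-1 - k).+1)%N by lia.
  rewrite TE; last by lia.
  rewrite sentN receivedN e (_ : (k + (i.-1 - k) = i.-1)%N); last by lia.
  by ring.
Qed.

Lemma relaxed_flow_convex t F H F' H' : 0 <= t <= 1 ->
  relaxed_flow F H -> relaxed_flow F' H' ->
  relaxed_flow (fun i => t * F i + (1 - t) * F' i)
               (fun i => t * H i + (1 - t) * H' i).
Proof.
move=> t01 [r b] [r' b']; split=> i i_n; first exact: relaxed_convex (r i i_n) (r' i i_n).
have [t0 t1] := andP t01; have t'0 : 0 <= 1 - t by rewrite subr_ge0.
by have := ler_wpM2l t0 (b i i_n); have := ler_wpM2l t'0 (b' i i_n); lra.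
Qed.

End Cut.

(** * From states to points of the arcs *)

Section Grid.
Context {R : realType} {n : nat} (G : network R n) (V : R).
Implicit Types (x y w : state R n) (i : 'I_n.+2) (e k : 'I_n.+1).

Definition impedance_sq e : R := resistance G e ^+ 2 + reactance G e ^+ 2.

Lemma impedance_sq_gt0 e : 0 < impedance_sq e.
Proof. by rewrite ltr_wpDl ?sqr_ge0// exprn_gt0 ?reactance_gt0. Qed.

(** The two equations of a line whose end voltages both have square [V]. *)
Definition line_law e (P Q l : R) : Prop :=
  [/\ 2 * (resistance G e * P + reactance G e * Q) = l * impedance_sq e,
      l * V = P ^+ 2 + Q ^+ 2 & 0 <= l].

Definition net_export (P Pin : 'I_n.+1 -> R) i : R :=
  - (\sum_(e | dst e == i) Pin e) + \sum_(e | src e == i) P e.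

Definition p_balance x i : R :=
  net_export (Pflow x) (fun e => Pflow x e - lsq x e * resistance G e) i.
Definition q_balance x i : R :=
  net_export (Qflow x) (fun e => Qflow x e - lsq x e * reactance G e) i.

Definition subgraph (N' : {set 'I_n.+2}) (E' : {set 'I_n.+1}) : Prop :=
  forall e, e \in E' -> src e \in N' /\ dst e \in N'.

Lemma sum_vanishing (E' : {set 'I_n.+1}) (P : pred 'I_n.+1) (f : 'I_n.+1 -> R) :
  (forall e, e \notin E' -> f e = 0) ->
  \sum_(e in E' | P e) f e = \sum_(e | P e) f e.
Proof.
move=> h; rewrite [RHS](bigID (mem E'))/= [X in _ + X]big1 ?addr0.
  by apply: eq_bigl => e; rewrite andbC.
by move=> e /andP[_ /h].
Qed.

Hypothesis hA2 : A2 G.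
Hypothesis hV : forall i, vmin G i = V%:E /\ vmax G i = V%:E.

(** The sums of the balance equations can be taken over all lines, because the
    flows vanish outside the subgraph; this makes states of different subgraphs
    comparable and easy to add up. *)
Lemma feasibleP N' E' x : subgraph N' E' -> 0 < V ->
  feasible G N' E' x <->
  [/\ forall e, line_law e (Pflow x e) (Qflow x e) (lsq x e),
      forall i, pinj x i = p_balance x i /\ qinj x i = q_balance x i,
      forall i, i \in N' -> vsq x i = V /\ Defs.within (pmin G i) (pinj x i) (pmax G i),
      forall e, e \in E' -> ((lsq x e)%:E <= lmax G e)%E &
      (forall i, i \notin N' -> [/\ pinj x i = 0, qinj x i = 0 & vsq x i = 0]) /\
      (forall e, e \notin E' ->
         [/\ Pflow x e = 0, Qflow x e = 0 & lsq x e = 0])].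
Proof.
move=> sub V0.
have sumE i : (forall e, e \notin E' ->
       [/\ Pflow x e = 0, Qflow x e = 0 & lsq x e = 0]) ->
  (- (\sum_(e in E' | dst e == i) (Pflow x e - lsq x e * resistance G e))
         + \sum_(e in E' | src e == i) Pflow x e = p_balance x i) /\
  (- (\sum_(e in E' | dst e == i) (Qflow x e - lsq x e * reactance G e))
         + \sum_(e in E' | src e == i) Qflow x e = q_balance x i).
  move=> z; split; congr (- _ + _); apply: sum_vanishing => e /z[];
    by [move=> -> _ ->; rewrite mul0r subrr|move=> _ -> ->; rewrite mul0r subrr| |].
have vE i : Defs.within (vmin G i) (vsq x i) (vmax G i) <-> vsq x i = V.
  have [-> ->] := hV i; rewrite /Defs.within !lee_fin; split=> [[h1 h2]|->//].
  by apply/eqP; rewrite eq_le h1 h2.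
split.
- move=> [[v0 l0] [pb qb] [vd lv] [bd ld] [zi ze]].
  have vV i : i \in N' -> vsq x i = V by move=> /bd[_ _ /vE].
  split=> // [e|i|i /[dup] iN /bd[]].
  + have [eE|/ze[-> -> ->]] := boolP (e \in E'); last first.
      by split; rewrite ?mulr0 ?mul0r ?expr0n ?addr0 ?mulr0.
    have [sN dN] := sub e eE.
    have := vd e eE; rewrite !vV// => h; have := lv e eE; rewrite vV// => h'.
    by split=> //; [move: h; rewrite /impedance_sq; lra|exact: l0].
  + have [h1 h2] := sumE i ze; rewrite -h1 -h2.
    have [iN|iN] := boolP (i \in N'); first by rewrite pb ?qb.
    have [-> -> _] := zi i iN; rewrite !big_pred0 ?oppr0 ?addr0// => e;
      apply/negbTE/negP => /andP[/sub[s d] /eqP ei]; move: iN;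
      by rewrite -ei ?s ?d.
  + by rewrite vV.
- move=> [law pq bd ld [zi ze]].
  have vV i : i \in N' -> vsq x i = V by move=> /bd[].
  split.
  + by split=> [i /vV->//|e eE]; case: (law e).
  + by split=> i iN; have [h1 h2] := sumE i ze; have [hp hq] := pq i; rewrite ?h1 ?h2.
  + split=> e eE; have [sN dN] := sub e eE; rewrite !vV//; case: (law e) => //.
    by rewrite /impedance_sq; lra.
  + split=> // i iN; have [_ b] := bd i iN; split=> //; last by apply/vE/vV.
    by have [_ -> ->] := hA2 i; rewrite /Defs.within leNye leey.
  + by [].
Qed.

Hypothesis V_gt0 : 0 < V.

Lemma grid_rad_gt0 e : 0 < 2 * V / impedance_sq e.
Proof. by rewrite divr_gt0 ?mulr_gt0 ?impedance_sq_gt0. Qed.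

Definition grid_line e : line R :=
  Line (lmax G e) (resistance_ge0 G e) (reactance_gt0 G e) (grid_rad_gt0 e).

(** The coordinate [u = c * sin theta] of a line, read off its flows. *)
Definition skew x e : R :=
  (2 * Pflow x e - lsq x e * resistance G e) / reactance G e.

(** Eliminating the reactive flow from the two line equations. *)
Lemma skew_circle x e : line_law e (Pflow x e) (Qflow x e) (lsq x e) ->
  (lrad (grid_line e) - lsq x e) ^+ 2 + skew x e ^+ 2 = lrad (grid_line e) ^+ 2.
Proof.
move=> [h1 h2 _]; rewrite /skew /=.
have x0 := lt0r_neq0 (reactance_gt0 G e).
have z0 := lt0r_neq0 (impedance_sq_gt0 e); move: h1 h2 z0; rewrite /impedance_sq.
move: (resistance G e) (reactance G e) x0 (Pflow x e) (Qflow x e) (lsq x e).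
move=> r X x0 P Q l h1 h2 z0.
have Q_E : Q = (l * (r ^+ 2 + X ^+ 2) - 2 * r * P) / (2 * X).
  by rewrite -h1; field.
have V_E : l * V * (4 * X ^+ 2)
   = (4 * P ^+ 2 + l ^+ 2 * (r ^+ 2 + X ^+ 2) - 4 * r * P * l) * (r ^+ 2 + X ^+ 2).
  by rewrite h2 Q_E; field.
apply/eqP; rewrite -subr_eq0.
have -> : (2 * V / (r ^+ 2 + X ^+ 2) - l) ^+ 2 + ((2 * P - l * r) / X) ^+ 2
  - (2 * V / (r ^+ 2 + X ^+ 2)) ^+ 2
  = ((4 * P ^+ 2 + l ^+ 2 * (r ^+ 2 + X ^+ 2) - 4 * r * P * l) * (r ^+ 2 + X ^+ 2)
     - l * V * (4 * X ^+ 2)) / ((r ^+ 2 + X ^+ 2) * X ^+ 2).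
  by field; rewrite x0 z0.
by rewrite V_E subrr mul0r.
Qed.

(** The complex number that defines the angle difference is
    [|z|^2 / 2 * (c - l + i u)], of modulus [|z|^2 / 2 * c] by [skew_circle]. *)
Lemma angle_diff_norm x e : vsq x (src e) = V ->
  line_law e (Pflow x e) (Qflow x e) (lsq x e) ->
  `|angle_diff G x e|
  = acos ((lrad (grid_line e) - lsq x e) / lrad (grid_line e)).
Proof.
move=> vV law; have circ := skew_circle law; have c0 := lrad_gt0 (grid_line e).
have z0 := impedance_sq_gt0 e.
have w_E : (vsq x (src e))%:C%C - (impedance G e)^*%C * Sflow x e
   = ((impedance_sq e / 2 * (lrad (grid_line e) - lsq x e)) +i* (impedance_sq e / 2 * skew x e))%C.
  case: law => h1 h2 _; rewrite vV /impedance /Sflow.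
  have x0 := lt0r_neq0 (reactance_gt0 G e).
  apply/eqP; rewrite eq_complex; apply/andP; split; apply/eqP => /=.
    move/lt0r_neq0: z0 h1 => z0 h1; rewrite mulrBr.
    have -> : impedance_sq e / 2 * (2 * V / impedance_sq e) = V by field.
    have -> : impedance_sq e / 2 * lsq x e
      = (2 * (resistance G e * Pflow x e + reactance G e * Qflow x e)) / 2.
      by rewrite h1; field.
    by field.
  rewrite /skew; move: h1; rewrite /impedance_sq.
  move: (resistance G e) (reactance G e) x0 (Pflow x e) (Qflow x e) (lsq x e).
  move=> r X x0 P Q l h1.
  have -> : Q = (l * (r ^+ 2 + X ^+ 2) - 2 * r * P) / (2 * X).
    by rewrite -h1; field.
  by field.
have zh : 0 < impedance_sq e / 2 by rewrite divr_gt0.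
have sq : (impedance_sq e / 2 * (lrad (grid_line e) - lsq x e)) ^+ 2
   + (impedance_sq e / 2 * skew x e) ^+ 2 = (impedance_sq e / 2 * lrad (grid_line e)) ^+ 2.
  by rewrite [RHS]exprMn -circ; ring.
rewrite /angle_diff w_E normr_arg; last by rewrite sq exprn_gt0// mulr_gt0.
rewrite sq sqrtr_sqr gtr0_norm; last by rewrite mulr_gt0.
congr (acos _).
move: (lrad (grid_line e)) c0 zh => c /lt0r_neq0 c0 /lt0r_neq0.
by move: (impedance_sq e / 2) => z z1; field; rewrite z1 c0.
Qed.

(** If [acos y < atan (x / r)] then [y] exceeds [cos (atan (x / r))], which is
    [r / |z|]. *)
Lemma acos_lt_angle_bound e (y : R) : -1 <= y <= 1 -> acos y < angle_bound G e ->
  0 < y /\ resistance G e ^+ 2 < (resistance G e ^+ 2 + reactance G e ^+ 2) * y ^+ 2.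
Proof.
move=> y1 ay.
have r0 := resistance_ge0 G e; have x0 := reactance_gt0 G e.
have [aN api] := (acos_ge0 y1, acos_lepi y1).
have pi0 : 0 < pi :> R := pi_gt0 R.
have bpi : 0 <= angle_bound G e <= pi / 2.
  rewrite (ltW (le_lt_trans aN ay))/= /angle_bound.
  by case: ifP => // _; rewrite ltW ?atan_ltpi2.
have cy : cos (angle_bound G e) < y.
  case/andP: bpi => b0 b1.
  rewrite -[ltRHS](acosK (x := y)) ?in_itv//= ltr_cos// in_itv/=;
    by apply/andP; split; lra.
have c0 : 0 <= cos (angle_bound G e).
  by apply: cos_ge0_pihalf; case/andP: bpi => h1 h2; apply/andP; split; lra.
have y0 : 0 < y by apply: le_lt_trans cy.
split=> //; move: cy; rewrite /angle_bound.
case: eqVneq => [->|rn0 cy].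
  by rewrite expr0n/= add0r mulr_gt0// exprn_gt0.
move: cy; rewrite cos_atan.
have t0 : 0 < 1 + (reactance G e / resistance G e) ^+ 2 by rewrite ltr_pwDl ?sqr_ge0.
rewrite invf_plt ?posrE ?sqrtr_gt0// => h.
have {}h : y^-1 ^+ 2 < 1 + (reactance G e / resistance G e) ^+ 2.
  by rewrite -[ltRHS]sqr_sqrtr ?(ltW t0)// ltrXn2r ?nnegrE ?invr_ge0 ?sqrtr_ge0 ?(ltW y0).
have rp : 0 < resistance G e ^+ 2 by rewrite exprn_even_gt0.
rewrite -(ltr_pM2l rp) in h; have yp : 0 < y ^+ 2 by rewrite exprn_gt0.
rewrite -(ltr_pM2r yp) in h.
move/lt0r_neq0: y0 => y0.
have e1 : resistance G e ^+ 2 * y^-1 ^+ 2 * y ^+ 2 = resistance G e ^+ 2 by field.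
have e2 : resistance G e ^+ 2 * (1 + (reactance G e / resistance G e) ^+ 2)
  = resistance G e ^+ 2 + reactance G e ^+ 2 by field.
by rewrite e1 e2 in h.
Qed.

Lemma skew_operable x e : vsq x (src e) = V ->
  line_law e (Pflow x e) (Qflow x e) (lsq x e) ->
  ((lsq x e)%:E <= lmax G e)%E -> `|angle_diff G x e| < angle_bound G e ->
  operable (grid_line e) (skew x e) /\ current (grid_line e) (skew x e) = lsq x e.
Proof.
move=> vV law llmax; rewrite (angle_diff_norm vV law).
have circ := skew_circle law; have c0 := lrad_gt0 (grid_line e).
set y := (X in acos X) => ay.
have cy : lrad (grid_line e) - lsq x e = lrad (grid_line e) * y.
  by rewrite /y mulrCA mulfV ?mulr1// lt0r_neq0.
have ysq : y ^+ 2 <= 1.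
  move: circ; rewrite cy exprMn => circ.
  rewrite -(ler_pM2l (exprn_gt0 2 c0)) mulr1 -[leRHS]circ lerDl.
  exact: sqr_ge0.
have y1 : -1 <= y <= 1.
  by rewrite -ler_norml -ler_sqr ?nnegrE ?normr_ge0// expr1n real_normK ?num_real.
have [y0 ry] := acos_lt_angle_bound y1 ay.
have hE : height (grid_line e) (skew x e) = lrad (grid_line e) * y.
  rewrite /height -circ addrK cy sqrtr_sqr ger0_norm//.
  by rewrite mulr_ge0 ?ltW.
have curE : current (grid_line e) (skew x e) = lsq x e.
  by rewrite /current hE -cy; ring.
split=> //; split; last by rewrite curE.
have r0 := resistance_ge0 G e; have x0 := reactance_gt0 G e.
rewrite hE -[ltLHS]ger0_norm ?mulr_ge0// -[ltRHS]ger0_norm; last first.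
  by apply: mulr_ge0; [exact: ltW|apply: mulr_ge0; exact: ltW].
rewrite -ltr_sqr ?nnegrE ?normr_ge0// !real_normK ?num_real//.
rewrite [ltLHS]exprMn real_normK ?num_real//.
have u_E : skew x e ^+ 2 = lrad (grid_line e) ^+ 2 * (1 - y ^+ 2).
  by move: circ; rewrite cy; lra.
rewrite u_E -subr_gt0.
have -> : (lrea (grid_line e) * (lrad (grid_line e) * y)) ^+ 2
   - lres (grid_line e) ^+ 2 * (lrad (grid_line e) ^+ 2 * (1 - y ^+ 2))
  = lrad (grid_line e) ^+ 2 * ((resistance G e ^+ 2 + reactance G e ^+ 2) * y ^+ 2
     - resistance G e ^+ 2) by rewrite /=; ring.
by rewrite mulr_gt0 ?exprn_gt0// subr_gt0.
Qed.

Lemma Pflow_revE x e : Pflow_rev G x e = - Pflow x e + lsq x e * resistance G e.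
Proof. by rewrite /Pflow_rev /Sflow_rev /Sflow /impedance /= mul0r subr0. Qed.

Lemma sent_skew x e : current (grid_line e) (skew x e) = lsq x e ->
  sent (grid_line e) (skew x e) = Pflow x e.
Proof.
move=> cE; rewrite /sent cE /= /skew.
by have x0 := lt0r_neq0 (reactance_gt0 G e); field.
Qed.

Lemma received_skew x e : current (grid_line e) (skew x e) = lsq x e ->
  received (grid_line e) (skew x e) = - Pflow_rev G x e.
Proof.
move=> cE; rewrite /received cE /= /skew Pflow_revE.
by have x0 := lt0r_neq0 (reactance_gt0 G e); field.
Qed.

Lemma sent_sub_loss e u :
  sent (grid_line e) u - current (grid_line e) u * resistance G e
  = received (grid_line e) u.
Proof. by rewrite /sent /received /=; field. Qed.

(** * From points of the arcs to states *)

(** The reactive flow that goes with [sent] on the circle of [skew_circle]. *)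
Definition reactive e (u : R) : R :=
  (reactance G e * current (grid_line e) u - resistance G e * u) / 2.

Lemma operable_line_law e u : operable (grid_line e) u ->
  line_law e (sent (grid_line e) u) (reactive e u) (current (grid_line e) u).
Proof.
move=> ou; have hs := sqr_height ou.
have z0 := lt0r_neq0 (impedance_sq_gt0 e).
split; last exact: current_ge0.
  by rewrite /sent /reactive /impedance_sq /=; field.
have cu : current (grid_line e) u ^+ 2 + u ^+ 2
   = 2 * (2 * V / impedance_sq e) * current (grid_line e) u.
  move: hs; rewrite /current /=; move: (height _ u) (2 * V / impedance_sq e) => h c hs.
  have {}hs : h ^+ 2 = c ^+ 2 - u ^+ 2 by rewrite -hs addrK.
  by ring: hs.
rewrite /sent /reactive /=.
move: (current _ _) cu => l cu.
have -> : ((reactance G e * u + resistance G e * l) / 2) ^+ 2 +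
   ((reactance G e * l - resistance G e * u) / 2) ^+ 2 =
   impedance_sq e * (l ^+ 2 + u ^+ 2) / 4 by rewrite /impedance_sq; field.
by rewrite cu; field.
Qed.
Lemma net_export_vanish N' E' (P Pin : 'I_n.+1 -> R) i :
  subgraph N' E' -> (forall e, e \notin E' -> P e = 0 /\ Pin e = 0) ->
  i \notin N' -> net_export P Pin i = 0.
Proof.
move=> sub z iN; rewrite /net_export !big1 ?oppr0 ?addr0// => e /eqP ei.
  have [/sub[s _]|/z[-> //]] := boolP (e \in E').
  by rewrite -ei s in iN.
have [/sub[_ s]|/z[_ -> //]] := boolP (e \in E').
by rewrite -ei s in iN.
Qed.

Definition pack (p q : 'I_n.+2 -> R) (P Q l : 'I_n.+1 -> R) (v : 'I_n.+2 -> R) :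
    state R n :=
  (\row_i p i, \row_i q i, \row_e P e, \row_e Q e, \row_e l e, \row_i v i).

Lemma packE p q P Q l v :
  [/\ pinj (pack p q P Q l v) = p, qinj (pack p q P Q l v) = q &
      vsq (pack p q P Q l v) = v] /\
  [/\ Pflow (pack p q P Q l v) = P, Qflow (pack p q P Q l v) = Q &
      lsq (pack p q P Q l v) = l].
Proof. by split; split; apply/funext => j; rewrite /pinj/qinj/vsq/Pflow/Qflow/lsq mxE. Qed.

Definition realize (N' : {set 'I_n.+2}) (u : 'I_n.+1 -> R) : state R n :=
  let P e := sent (grid_line e) (u e) in
  let Q e := reactive e (u e) in
  let l e := current (grid_line e) (u e) in
  pack (net_export P (fun e => received (grid_line e) (u e)))
       (net_export Q (fun e => Q e - l e * reactance G e))
       P Q l (fun i => if i \in N' then V else 0).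

Lemma realize_feasible N' E' (u : 'I_n.+1 -> R) :
  subgraph N' E' -> (forall e, operable (grid_line e) (u e)) ->
  (forall e, e \notin E' -> u e = 0) ->
  (forall i, i \in N' -> Defs.within (pmin G i)
     (net_export (fun e => sent (grid_line e) (u e))
                 (fun e => received (grid_line e) (u e)) i) (pmax G i)) ->
  feasible G N' E' (realize N' u).
Proof.
move=> sub ou zu bd; rewrite /realize; apply/(feasibleP _ sub V_gt0).
set p := net_export _ _; set q := net_export _ _; set P := fun e => sent _ _.
set Q := fun e => reactive _ _; set l := fun e => current _ _; set v := fun i => _.
rewrite /p_balance /q_balance.
have [[-> -> ->] [-> -> ->]] := packE p q P Q l v.
have z e : e \notin E' -> [/\ P e = 0, Q e = 0 & l e = 0].
  by move=> /zu u0; rewrite /P /Q /l u0 sent0 /reactive current0 !mulr0 subrr mul0r.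
split=> //.
- by move=> e; apply: operable_line_law.
- move=> i; split=> //; rewrite /p /net_export; congr (- _ + _).
  by apply: eq_bigr => e _; rewrite sent_sub_loss.
- by move=> i iN; rewrite /v iN; split=> //; exact: bd.
- by move=> e _; case: (ou e).
- split=> // i iN; rewrite /v (negbTE iN); split=> //.
    apply: (net_export_vanish sub) iN => e eE.
    by rewrite /= zu// sent0 received0.
  apply: (net_export_vanish sub) iN => e eE; rewrite /= zu//.
  by rewrite /reactive current0 !mulr0 !mul0r !subr0 mul0r.
Qed.

Lemma net_exportE (P Pin : 'I_n.+1 -> R) i :
  net_export P Pin i = - (if (0 < i)%N then Pin (inord i.-1) else 0)
                       + (if (i <= n)%N then P (inord i) else 0).
Proof.
rewrite /net_export; congr (- _ + _).
  case: ifP => i0; last first.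
    rewrite big_pred0// => e; apply/negbTE; apply/eqP => /(congr1 val).
    by rewrite /= /bump/= => h; rewrite -h in i0.
  rewrite (big_pred1 (inord i.-1))// => e /=.
  rewrite -!val_eqE /= /bump/= inordK; first by rewrite add1n -[in RHS]eqSS prednK.
  by have := ltn_ord i; case: (nat_of_ord i) i0.
case: ifP => i0; last first.
  rewrite big_pred0// => e; apply/negbTE; apply/eqP => /(congr1 val)/= h.
  by have := ltn_ord e; rewrite h ltnS i0.
by rewrite (big_pred1 (inord i))// => e /=; rewrite -!val_eqE /= inordK.
Qed.

Lemma subgraph_net : subgraph [set: _]%SET [set: _]%SET.
Proof. by move=> e _; rewrite !inE. Qed.

Lemma subgraph_left k :
  subgraph [set i : 'I_n.+2 | (i <= k)%N]%SET [set e : 'I_n.+1 | (e < k)%N]%SET.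
Proof. by move=> e; rewrite !inE /= /bump/= add1n => h; split=> //; exact: ltnW. Qed.

Lemma subgraph_right k :
  subgraph [set i : 'I_n.+2 | (k < i)%N]%SET [set e : 'I_n.+1 | (k < e)%N]%SET.
Proof. by move=> e; rewrite !inE /= /bump/= add1n => h; split=> //; exact: ltnW. Qed.

(** * Cutting the network at a line *)

(** States of a subtree vanish outside it, so states of the two subtrees of a
    cut are put together by adding them. *)
Definition glue y w : state R n :=
  pack (fun i => pinj y i + pinj w i) (fun i => qinj y i + qinj w i)
       (fun e => Pflow y e + Pflow w e) (fun e => Qflow y e + Qflow w e)
       (fun e => lsq y e + lsq w e) (fun i => vsq y i + vsq w i).

(** The line that was cut carries nothing; as both its ends have the same
    voltage, it obeys the line equations. In particular, [A3] applies to the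
    states of the subtrees through this extension. *)
Lemma glue_feasible k y w : (0%:E <= lmax G k)%E ->
  feasible_left G k y -> feasible_right G k w ->
  [/\ feasible_net G (glue y w), Pflow (glue y w) k = 0, Pflow_rev G (glue y w) k = 0,
      pinj (glue y w) ord0 = pinj y ord0 &
      pinj (glue y w) ord_max = pinj w ord_max].
Proof.
move=> lk /(feasibleP _ (@subgraph_left k) V_gt0) [lawy pqy bdy ldy [ziy zey]].
move=> /(feasibleP _ (@subgraph_right k) V_gt0) [laww pqw bdw ldw [ziw zew]].
have offy e : ~~ (e < k)%N -> [/\ Pflow y e = 0, Qflow y e = 0 & lsq y e = 0].
  by move=> h; apply: zey; rewrite inE.
have offw e : ~~ (k < e)%N -> [/\ Pflow w e = 0, Qflow w e = 0 & lsq w e = 0].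
  by move=> h; apply: zew; rewrite inE.
have offyi i : ~~ (i <= k)%N -> [/\ pinj y i = 0, qinj y i = 0 & vsq y i = 0].
  by move=> h; apply: ziy; rewrite inE.
have offwi i : ~~ (k < i)%N -> [/\ pinj w i = 0, qinj w i = 0 & vsq w i = 0].
  by move=> h; apply: ziw; rewrite inE.
rewrite Pflow_revE /glue.
set p := fun i => pinj _ _ + _; set q := fun i => qinj _ _ + _.
set P := fun e => Pflow _ _ + _; set Q := fun e => Qflow _ _ + _.
set l := fun e => lsq _ _ + _; set v := fun i => vsq _ _ + _.
have [[pE qE vE] [PE QE lE]] := packE p q P Q l v.
have [yk1 yk2 yk3] : [/\ Pflow y k = 0, Qflow y k = 0 & lsq y k = 0].
  by apply: offy; rewrite ltnn.
have [wk1 wk2 wk3] : [/\ Pflow w k = 0, Qflow w k = 0 & lsq w k = 0].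
  by apply: offw; rewrite ltnn.
have Pk0 : P k = 0 by rewrite /P yk1 wk1 addr0.
have lk0 : l k = 0 by rewrite /l yk3 wk3 addr0.
rewrite PE lE pE Pk0 lk0 mul0r oppr0 addr0; split=> //; last 2 first.
- by rewrite /p; have [-> _ _] := offwi ord0 isT; rewrite addr0.
- rewrite /p; have [|-> _ _] := offyi ord_max; last by rewrite add0r.
  by rewrite /= -ltnNge ltn_ord.
apply/(feasibleP _ subgraph_net V_gt0); rewrite /p_balance /q_balance pE qE vE PE QE lE.
split.
- move=> e; rewrite /P /Q /l; have [ek|ek] := boolP (e < k)%N.
    have [|-> -> ->] := offw e; first by rewrite -leqNgt ltnW.
    by rewrite !addr0.
  by have [-> -> ->] := offy e ek; rewrite !add0r.
- move=> i; rewrite /p /q; have [-> ->] := pqy i; have [-> ->] := pqw i.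
  rewrite /p_balance /q_balance /net_export; split.
    rewrite [in RHS](eq_bigr (fun e => (Pflow y e - lsq y e * resistance G e)
      + (Pflow w e - lsq w e * resistance G e))).
      by rewrite !big_split/=; ring.
    by move=> e _; rewrite /P /l; ring.
  rewrite [in RHS](eq_bigr (fun e => (Qflow y e - lsq y e * reactance G e)
    + (Qflow w e - lsq w e * reactance G e))).
    by rewrite !big_split/=; ring.
  by move=> e _; rewrite /Q /l; ring.
- move=> i _; rewrite /v /p; have [ik|ik] := boolP (i <= k)%N.
    have [|-> _ ->] := offwi i; first by rewrite -leqNgt.
    by rewrite !addr0; apply: bdy; rewrite inE.
  have [-> _ ->] := offyi i ik; rewrite !add0r; apply: bdw.
  by rewrite inE ltnNge.
- move=> e _; rewrite /l; have [ek|] := boolP (e < k)%N.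
    have [|_ _ ->] := offw e; first by rewrite -leqNgt ltnW.
    by rewrite addr0; apply: ldy; rewrite inE.
  move=> /[dup] /offy[_ _ ->]; rewrite add0r -leqNgt leq_eqVlt => /orP[/eqP ke|ke].
    by rewrite (_ : e = k) ?wk3//; apply/val_inj.
  by apply: ldw; rewrite inE.
- by split=> [i|e]; rewrite inE.
Qed.

Hypotheses (hA1 : A1 G) (hA3 : A3 G) (hA4 : A4 G).

Definition nline (i : nat) : line R := grid_line (inord i).
Definition nload (i : nat) : R := - fine (pmax G (inord i)).
Definition outflow x (i : nat) : R := Pflow x (inord i).
Definition inflow x (i : nat) : R := - Pflow_rev G x (inord i).

Lemma pinj_netE x (i : 'I_n.+2) : feasible_net G x ->
  pinj x i = - (if (0 < i)%N then inflow x i.-1 else 0)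
             + (if (i <= n)%N then outflow x i else 0).
Proof.
move=> /(feasibleP _ subgraph_net V_gt0) [_ /(_ i)[-> _] _ _ _].
rewrite /p_balance net_exportE; congr (- _ + _); case: ifP => // _.
by rewrite /inflow Pflow_revE opprD opprK.
Qed.

Lemma pinj_firstE x : feasible_net G x -> pinj x ord0 = outflow x 0.
Proof. by move=> fx; rewrite pinj_netE//= oppr0 add0r. Qed.

Lemma pinj_lastE x : feasible_net G x -> pinj x ord_max = - inflow x n.
Proof. by move=> fx; rewrite pinj_netE//= ltnn addr0. Qed.

Lemma net_within x i : feasible_net G x -> Defs.within (pmin G i) (pinj x i) (pmax G i).
Proof. by move=> [_ _ _ [/(_ i (finset.in_setT _))[]]]. Qed.

(** The upper bound of a load is finite: it is negative, and a feasible state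
    lies below it. *)
Lemma load_bus (i : nat) : (i < n)%N ->
  nload i.+1 > 0 /\ pmax G (inord i.+1) = (- nload i.+1)%:E.
Proof.
move=> i_n; have [_ [x fx] _ _] := hA4.
have [lo hi] := net_within (inord i.+1) fx.
have neg : (pmax G (inord i.+1) < 0)%E.
  apply: hA1.1; rewrite /is_substation -!val_eqE /= inordK ?ltnS ?(ltnW i_n)//=.
  by rewrite eqSS ltn_eqF.
rewrite /nload opprK.
by case: (pmax G (inord i.+1)) neg hi => [p| |]//=; rewrite lte_fin oppr_gt0.
Qed.

(** The angle condition places the flows of every line on the arc where they
    are monotone; the upper load bounds become lower bounds on consumption. *)
Lemma net_relaxed x : feasible_net G x ->
  relaxed_flow n nline nload (outflow x) (inflow x).
Proof.
move=> fx; have [law _ bd ld _] := (feasibleP x subgraph_net V_gt0).1 fx.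
split=> i i_n.
  pose e : 'I_n.+1 := inord i.
  have [|||oe ce] := @skew_operable x e _ (law e).
  - by have [] := bd (src e) (finset.in_setT _).
  - by apply: ld; rewrite inE.
  - exact: hA3.
  by exists (skew x e); rewrite /nline sent_skew// received_skew.
have [d0 dE] := load_bus i_n.
have [_] := net_within (inord i.+1) fx.
rewrite dE lee_fin pinj_netE// inordK ?ltnS ?(ltnW i_n)//= i_n.
by lra.
Qed.

Lemma nload_ge0 (i : nat) : (i < n)%N -> 0 <= nload i.+1.
Proof. by move=> /load_bus[/ltW]. Qed.

Lemma lmax_ge0 k : (0%:E <= lmax G k)%E.
Proof.
have [_ [x fx] _ _] := hA4.
have [law _ _ ld _] := (feasibleP x subgraph_net V_gt0).1 fx.
have /ld : k \in [set: 'I_n.+1]%SET by rewrite inE.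
by apply: le_trans; rewrite lee_fin; case: (law k).
Qed.

(** Any two states of the subtrees give a relaxed flow with nothing on line [k];
    the existence of the cut profile and its bounds are deduced from it. *)
Lemma net_disconnected k :
  exists x, [/\ feasible_net G x, outflow x k = 0 & inflow x k = 0].
Proof.
have [_ _ /(_ k)[y fy] /(_ k)[w fw]] := hA4.
have [fx P0 P'0 _ _] := glue_feasible (lmax_ge0 k) fy fw.
by exists (glue y w); rewrite /outflow /inflow inord_val P0 P'0 oppr0.
Qed.

Definition cut_skew k e : R := cut_profile nline nload k e.

Lemma cut_operable k e : operable (grid_line e) (cut_skew k e).
Proof.
have [x [fx F0 H0]] := net_disconnected k; have rx := net_relaxed fx.
have kn : (k <= n)%N by rewrite -ltnS.
have eE : grid_line e = nline e by rewrite /nline inord_val.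
rewrite /cut_skew eE; have [ek|ke] := leqP e k.
  by have [] := cut_left nload_ge0 kn rx _ ek; rewrite ?F0.
have [] := @cut_right _ _ _ _ nload_ge0 _ _ _ kn rx _ e; rewrite ?H0//.
by rewrite ltnW//= -ltnS.
Qed.

(** When line [0] is removed, substation [0] is an isolated bus, and the
    feasibility of that subtree puts [0] within its bounds. *)
Lemma pmin_first_le0 : (pmin G ord0 <= 0%:E)%E.
Proof.
have [x [fx F0 H0]] := net_disconnected ord0.
by have [+ _] := net_within ord0 fx; rewrite pinj_firstE// F0.
Qed.

Lemma pmin_last_le0 : (pmin G ord_max <= 0%:E)%E.
Proof.
have [x [fx F0 H0]] := net_disconnected ord_max.
by have [+ _] := net_within ord_max fx; rewrite pinj_lastE// H0 oppr0.
Qed.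

(** Loads are at their upper bound. Each substation injects a nonnegative amount,
    hence at least its lower bound, and no more than it does in any feasible
    state with nothing on line [k]. *)
Lemma cut_within k i : Defs.within (pmin G i)
  (net_export (fun e => sent (grid_line e) (cut_skew k e))
              (fun e => received (grid_line e) (cut_skew k e)) i) (pmax G i).
Proof.
have [x [fx F0 H0]] := net_disconnected k; have rx := net_relaxed fx.
have kn : (k <= n)%N by rewrite -ltnS.
have left := cut_left nload_ge0 kn rx; rewrite F0 in left.
have right := @cut_right _ _ _ _ nload_ge0 _ _ _ kn rx; rewrite H0 in right.
have [lo hi] := net_within i fx.
rewrite net_exportE /cut_skew.
have [i0|i0] := posnP i.
  have -> /= : i = ord0 by apply: val_inj.
  have [_ T0 TF _] := left (lexx _) 0 (leq0n _).
  rewrite oppr0 add0r inordK//; split.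
    by apply: le_trans pmin_first_le0 _; rewrite lee_fin sent_ge0.
  have {}i0 : i = ord0 by apply: val_inj.
  by move: hi; rewrite i0; apply: le_trans; rewrite lee_fin pinj_firstE.
have [i_n|i_n] := leqP i n; last first.
  have -> /= : i = ord_max.
    by apply: val_inj; apply/eqP; rewrite eqn_leq /= i_n -ltnS ltn_ord.
  have [|_ T0 TH _] := right (lexx _) n; first by rewrite kn leqnn.
  rewrite addr0 inordK//; split.
    apply: le_trans pmin_last_le0 _.
    by rewrite lee_fin -sentN sent_ge0// oppr_ge0.
  have {}i0 : i = ord_max.
    by apply: val_inj; apply/eqP; rewrite eqn_leq /= i_n -ltnS ltn_ord.
  by move: hi; rewrite i0; apply: le_trans; rewrite lee_fin pinj_lastE// lerN2.
have iE : i = i.-1.+1 :> nat by rewrite prednK.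
have ipn : (i.-1 < n)%N by rewrite -iE.
have [d0 dE] := load_bus ipn; rewrite -iE inord_val in dE.
rewrite !inordK// ?ltnS ?(ltnW ipn)// -/(nline _) -/(nline _).
have -> : - received (nline i.-1) (cut_profile nline nload k i.-1)
          + sent (nline i) (cut_profile nline nload k i) = - nload i.
  have [ik|ki] := leqP i k.
    have [|_ _ _] := left (lexx _) i.-1; first by rewrite -ltnS -iE ltnW.
    rewrite -iE => /(_ ik) ->; ring.
  have [|_ _ _] := right (lexx _) i; first by rewrite ltnW.
  by move=> /(_ ki) <-; ring.
by split; rewrite -dE//; apply: le_trans lo hi.
Qed.

Definition cut_net k : state R n := realize [set: _]%SET (cut_skew k).

Lemma cut_net_feasible k : feasible_net G (cut_net k).
Proof.
apply: realize_feasible => [|e|e|i _].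
- exact: subgraph_net.
- exact: cut_operable.
- by rewrite inE.
- exact: cut_within.
Qed.

Lemma realize_pinj N' u i : pinj (realize N' u) i
  = net_export (fun e => sent (grid_line e) (u e))
               (fun e => received (grid_line e) (u e)) i.
Proof. by rewrite /pinj mxE. Qed.

Lemma cut_pinj_first k : pinj (cut_net k) ord0
  = sent (nline 0) (cut_profile nline nload k 0).
Proof. by rewrite realize_pinj net_exportE/= oppr0 add0r /cut_skew inordK. Qed.

Lemma cut_pinj_last k : pinj (cut_net k) ord_max
  = - received (nline n) (cut_profile nline nload k n).
Proof. by rewrite realize_pinj net_exportE/= ltnn addr0 /cut_skew inordK. Qed.

(** Restriction of the cut state to one of the two subtrees. The only line
    missing at a bus of the subtree is the cut line, whose flow is zero, so the
    injections do not change. *)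
Lemma realize_cut_feasible k N' E' : subgraph N' E' ->
  (forall i, i \in N' -> forall e, src e = i \/ dst e = i -> e \in E' \/ e = k) ->
  exists2 y, feasible G N' E' y &
    forall i, i \in N' -> pinj y i = pinj (cut_net k) i.
Proof.
move=> sub inc.
pose u e := if e \in E' then cut_skew k e else 0.
have kk : cut_skew k k = 0 by rewrite /cut_skew cut_profileE.
have uE i : i \in N' ->
    net_export (fun e => sent (grid_line e) (u e))
               (fun e => received (grid_line e) (u e)) i
  = net_export (fun e => sent (grid_line e) (cut_skew k e))
               (fun e => received (grid_line e) (cut_skew k e)) i.
  move=> iN; have ue e : src e = i \/ dst e = i -> u e = cut_skew k e.
    by move=> /(inc i iN); rewrite /u; case: ifP => // _ [//|->].
  by rewrite /net_export; congr (- _ + _); apply: eq_bigr => e /eqP ei; rewrite ue//;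
    [right|left].
exists (realize N' u); last by move=> i iN; rewrite !realize_pinj uE.
apply: realize_feasible sub _ _ _.
- move=> e; rewrite /u; case: ifP => _; first exact: cut_operable.
  by apply: operable_le (cut_operable k e) _; rewrite normr0.
- by move=> e eE; rewrite /u (negbTE eE).
- by move=> i iN; rewrite uE//; exact: cut_within.
Qed.

(** A state of the left subtree, completed by any state of the right one, is a
    relaxed flow with nothing on line [k], hence dominates the cut state. *)
Lemma p0_leftE k : p0_left G k = sent (nline 0) (cut_profile nline nload k 0).
Proof.
have kn : (k <= n)%N by rewrite -ltnS.
apply: minimumP.
  have [|y fy yE] := realize_cut_feasible (k := k) (@subgraph_left k).
    move=> i; rewrite inE => ik e; rewrite inE => -[] /(congr1 val) /=.
      move=> ei; move: ik; rewrite -ei leq_eqVlt => /orP[/eqP h|->]; last by left.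
      by right; apply: val_inj.
    by rewrite /bump/= add1n => ei; left; rewrite ei.
  by exists y => //; rewrite yE ?inE// cut_pinj_first.
move=> _ [y fy <-]; have [_ _ _ /(_ k)[w fw]] := hA4.
have [fx P0 _ <- _] := glue_feasible (lmax_ge0 k) fy fw.
rewrite pinj_firstE//.
have [|_ _ //] := cut_left nload_ge0 kn (net_relaxed fx) _ (leq0n k).
by rewrite /outflow inord_val P0.
Qed.

Lemma p0_rightE k : p0_right G k = - received (nline n) (cut_profile nline nload k n).
Proof.
have kn : (k <= n)%N by rewrite -ltnS.
apply: minimumP.
  have [|y fy yE] := realize_cut_feasible (k := k) (@subgraph_right k).
    move=> i; rewrite inE => ki e; rewrite inE => -[] /(congr1 val) /=.
      by move=> ei; left; rewrite ei.
    rewrite /bump/= add1n => ei; move: ki; rewrite -ei ltnS leq_eqVlt.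
    move=> /orP[/eqP h|->]; last by left.
    by right; apply: val_inj.
  by exists y => //; rewrite yE ?inE//= cut_pinj_last.
move=> _ [w fw <-]; have [_ _ /(_ k)[y fy] _] := hA4.
have [fx _ P0 _ <-] := glue_feasible (lmax_ge0 k) fy fw.
rewrite pinj_lastE// lerN2.
have Hk : inflow (glue y w) k <= 0 by rewrite /inflow inord_val P0 oppr0.
have nn : (k <= n <= n)%N by rewrite kn leqnn.
by have [] := cut_right nload_ge0 kn (net_relaxed fx) Hk nn.
Qed.

(** * Comparing the costs of cuts *)

Variable Gamma : R * R -> R.
Hypotheses (hconvex : convex_cost Gamma) (hincr : increasing_cost Gamma).

Lemma OFR_cost_le k F H : relaxed_flow n nline nload F H ->
  0 <= F k -> H k <= 0 -> OFR_cost G Gamma k <= Gamma (F 0, - H n).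
Proof.
move=> rel Fk Hk; have kn : (k <= n)%N by rewrite -ltnS.
apply: hincr.
  by rewrite p0_leftE; have [] := cut_left nload_ge0 kn rel Fk (leq0n k).
rewrite p0_rightE lerN2.
have nn : (k <= n <= n)%N by rewrite kn leqnn.
by have [] := cut_right nload_ge0 kn rel Hk nn.
Qed.

Lemma outflow_cut k (i : nat) : (i <= n)%N ->
  outflow (cut_net k) i = sent (nline i) (cut_profile nline nload k i).
Proof. by move=> i_n; rewrite /outflow /Pflow mxE /cut_skew inordK. Qed.

Lemma inflow_cut k (i : nat) : (i <= n)%N ->
  inflow (cut_net k) i = received (nline i) (cut_profile nline nload k i).
Proof.
move=> i_n; rewrite /inflow Pflow_revE /Pflow /lsq !mxE opprD opprK.
by rewrite sent_sub_loss /cut_skew inordK.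
Qed.

Lemma outflow_cut_ge0 k (j : 'I_n.+1) : (k <= j)%N -> 0 <= outflow (cut_net j) k.
Proof.
move=> kj; have [y [fy F0 _]] := net_disconnected j.
have jn : (j <= n)%N by rewrite -ltnS.
rewrite outflow_cut ?(leq_trans kj)// sent_ge0//.
by have [|] := cut_left nload_ge0 jn (net_relaxed fy) _ kj; rewrite ?F0.
Qed.

Lemma inflow_cut_le0 k (j : 'I_n.+1) : (j <= k)%N -> inflow (cut_net j) k <= 0.
Proof.
move=> jk; have [y [fy _ H0]] := net_disconnected j.
have kn : (k <= n)%N by rewrite -ltnS.
have jn := leq_trans jk kn.
rewrite inflow_cut// -oppr_ge0 -sentN sent_ge0// oppr_ge0.
have Hj : inflow y j <= 0 by rewrite H0.
have jkn : (j <= k <= n)%N by rewrite jk.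
by have [] := cut_right nload_ge0 jn (net_relaxed fy) Hj jkn.
Qed.

Lemma OFR_costE k :
  OFR_cost G Gamma k = Gamma (outflow (cut_net k) 0, - inflow (cut_net k) n).
Proof. by rewrite /OFR_cost p0_leftE p0_rightE outflow_cut// inflow_cut. Qed.

Variables (x : state R n) (hx : OPF_optimal G Gamma x).

Lemma OPF_le_OFR_cost (j : 'I_n.+1) :
  Gamma (outflow x 0, - inflow x n) <= OFR_cost G Gamma j.
Proof.
case: hx => fx /(_ _ (cut_net_feasible j)).
by rewrite OFR_costE !pinj_firstE ?pinj_lastE//; exact: cut_net_feasible.
Qed.

(** The combination costs at most the larger of the two costs, which is that of
    the cut state of [j] since [x] is optimal. *)
Lemma OFR_cost_le_mix k (j : 'I_n.+1) t : 0 <= t <= 1 ->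
  0 <= t * outflow x k + (1 - t) * outflow (cut_net j) k ->
  t * inflow x k + (1 - t) * inflow (cut_net j) k <= 0 ->
  OFR_cost G Gamma k <= OFR_cost G Gamma j.
Proof.
move=> t01 Fk Hk; have [t0 t1] := andP t01.
have rx := net_relaxed hx.1; have rj := net_relaxed (cut_net_feasible j).
have := OFR_cost_le (relaxed_flow_convex t01 rx rj) Fk Hk.
move/le_trans; apply.
have -> : - (t * inflow x n + (1 - t) * inflow (cut_net j) n)
  = t * - inflow x n + (1 - t) * - inflow (cut_net j) n by ring.
apply: le_trans (convex_costP _ _ _ _ hconvex t01) _.
rewrite -OFR_costE; have := OPF_le_OFR_cost j.
by move/(ler_wpM2l t0); lra.
Qed.

(** The two halves of [x] are relaxed flows for the two subtrees, since power
    that was sent into line [k] need not be sent after its removal. *)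
Lemma OFR_optimal_both_ends k : 0 <= Pflow x k -> 0 <= Pflow_rev G x k ->
  OFR_optimal G Gamma k.
Proof.
move=> Fk Hk j; apply: le_trans (OPF_le_OFR_cost j).
apply: OFR_cost_le (net_relaxed hx.1) _ _; rewrite /outflow /inflow inord_val//.
by rewrite oppr_le0.
Qed.

(** The flow at the left end of [k] is nonpositive in [x] and nonnegative in the
    cut state of [j]. In the combination where it vanishes, the flow at the
    right end is nonpositive because lines only lose power. *)
Lemma OFR_cost_le_right k (j : 'I_n.+1) : Pflow x k <= 0 -> (k <= j)%N ->
  OFR_cost G Gamma k <= OFR_cost G Gamma j.
Proof.
move=> Pk kj; have kn : (k <= n)%N by rewrite -ltnS.
have Fk : outflow x k <= 0 by rewrite /outflow inord_val.
have [t t01 e0] := convex_zero Fk (outflow_cut_ge0 kj).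
apply: (OFR_cost_le_mix t01); first by rewrite e0.
have [rel _] := relaxed_flow_convex t01 (net_relaxed hx.1)
                  (net_relaxed (cut_net_feasible j)).
by rewrite -e0; exact: relaxed_le (rel k kn).
Qed.

Lemma OFR_cost_le_left k (j : 'I_n.+1) : Pflow_rev G x k <= 0 -> (j <= k)%N ->
  OFR_cost G Gamma k <= OFR_cost G Gamma j.
Proof.
move=> Pk jk; have kn : (k <= n)%N by rewrite -ltnS.
have Hk : 0 <= inflow x k by rewrite /inflow inord_val oppr_ge0.
have [t t01 e0] := convex_zero (inflow_cut_le0 jk) Hk.
have t01' : 0 <= 1 - t <= 1 by lra.
have {}e0 : (1 - t) * inflow x k + (1 - (1 - t)) * inflow (cut_net j) k = 0.
  by rewrite -[RHS]e0; ring.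
apply: (OFR_cost_le_mix t01'); last by rewrite e0.
have [rel _] := relaxed_flow_convex t01' (net_relaxed hx.1)
                  (net_relaxed (cut_net_feasible j)).
by rewrite -e0; exact: relaxed_le (rel k kn).
Qed.

(** In the last case the two adjacent lines leave no gap: the left one is no worse
    than the lines to its left, the right one no worse than those to its right,
    and the algorithm takes the better of the two. *)
Lemma alg1_optimal e : alg1 G Gamma x e -> OFR_optimal G Gamma e.
Proof.
case=> [P0|Pn|k Pk Pk'|d k kd Pd Pk] j.
- exact: OFR_cost_le_right.
(* Bus [n] sends power towards [0']: either [0'] receives power, or both ends of
   the last line send. *)
- have [Pn'|/ltW Pn'] := leP (Pflow_rev G x ord_max) 0.
    by apply: OFR_cost_le_left => //; rewrite -ltnS.
  exact: OFR_optimal_both_ends.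
- exact: OFR_optimal_both_ends.
have [jd|dj] := leqP j d.
  have := OFR_cost_le_left Pd jd; case: ifP => // kd' h.
  exact: le_trans h.
have := @OFR_cost_le_right k j Pk; rewrite kd => /(_ dj) h.
by case: ifP => // /negbT; rewrite -ltNge => /ltW; move/le_trans; apply.
Qed.

(** If the first two cases fail, look at the leftmost line that does not send
    power from its left end: the line before it does, and the sign at the right
    end of that line decides between the last two cases. *)
Lemma alg1_returns : exists e, alg1 G Gamma x e.
Proof.
have [P0|P0] := leP (Pflow x ord0) 0; first by exists ord0; exact: alg1_first.
have [Pn|Pn] := leP 0 (Pflow x ord_max); first by exists ord_max; exact: alg1_last.
have ex : exists i : nat, (i <= n)%N && (Pflow x (inord i) <= 0).
  exists n; rewrite leqnn/=; apply: ltW; move: Pn.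
  by congr (Pflow x _ < 0); apply: val_inj; rewrite /= inordK.
case: (ex_minnP ex) => -[/andP[_]|m /andP[mn Pm] min].
  by rewrite leNgt (_ : inord 0 = ord0) ?P0//; apply: val_inj; rewrite /= inordK.
have mn' : (m <= n)%N by exact: ltnW.
have Pd : 0 < Pflow x (inord m).
  rewrite ltNge; apply/negP => h.
  by have := min m; rewrite mn' h ltnn => /(_ isT).
have [Pd'|/ltW Pd'] := leP 0 (Pflow_rev G x (inord m)).
  by exists (inord m); apply: alg1_line => //; exact: ltW.
eexists; apply: (@alg1_bus _ _ _ _ _ (inord m) (inord m.+1)) => //.
by rewrite !inordK// ltnS.
Qed.

End Grid.

Theorem theorem3 (R : realType) (n : nat) (G : network R n)
    (Gamma : R * R -> R)
    (hconvex : convex_cost Gamma) (hincr : increasing_cost Gamma)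
    (hA1 : A1 G) (hA2 : A2 G) (hA3 : A3 G) (hA4 : A4 G)
    (V : R) (hV : forall i : 'I_n.+2, vmin G i = V%:E /\ vmax G i = V%:E)
    (x : state R n) (hx : OPF_optimal G Gamma x) :
  (exists e : 'I_n.+1, alg1 G Gamma x e) /\
  (forall e : 'I_n.+1, alg1 G Gamma x e -> OFR_optimal G Gamma e).
Proof.
split=> [|e]; first exact: alg1_returns.
have V_gt0 : 0 < V.
  have [[[v0 _] _ _ [vb _] _] _] := hx.
  have iN : ord0 \in [set: 'I_n.+2]%SET by rewrite inE.
  have [_ _ [_]] := vb _ iN; rewrite (hV ord0).2 lee_fin.
  exact: lt_le_trans (v0 _ iN).
exact: (alg1_optimal hA2 hV V_gt0 hA1 hA3 hA4 hconvex hincr hx).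
Qed.
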